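(* Let $X_1,X_2,\dots$ be independent, identically distributed random variables taking values in the positive integers, let $X$ denote a random variable with their common distribution, and assume $\gcd(\operatorname{Supp} X)=1$. Let $W_n=X_1+\dots+X_n$ for $n\ge 1$ (so, with $W_0=0$, the gaps $W_n-W_{n-1}=X_n$ are i.i.d.). If $\mathbb{E}[X]<2$ (in particular finite), then with probability $1$ the sequence $\{W_n\}_{n\ge1}$ is asymptotically $2$-complete.
   Context: $\operatorname{Supp}X=\{x\in\mathbb{N}: P(X=x)>0\}$. An increasing sequence $\bar w=\{w_n\}_{n\ge1}$ of positive integers is called asymptotically $k$-complete if every sufficiently large integer can be written as the sum of exactly $k$ distinct elements of $\bar w$; i.e. there is $N$ such that every integer $m\ge N$ equals $w_{i_1}+\dots+w_{i_k}$ for some $i_1<\dots<i_k$. (The threshold $N$ may depend on the realization of the sequence.) *)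

(* Defs.v *)
From HB Require Import structures.
From mathcomp Require Import all_boot all_order all_algebra.
From mathcomp Require Import all_classical all_reals all_analysis.

Set Implicit Arguments.
Unset Strict Implicit.
Unset Printing Implicit Defensive.

Local Open Scope classical_set_scope.

(* Sequences are indexed from 0: the term [w n] stands for w_(n+1) in a
   sequence w_1, w_2, ... *)

Definition is_gcd (A : set nat) (g : nat) : Prop :=
  (forall x, A x -> g %| x) /\
  (forall e, (forall x, A x -> e %| x) -> e %| g).

(* The terms of an increasing sequence being distinct, k distinct elements
   are the same as k distinct indices, listed here in increasing order. *)
Definition asymptotically_complete (k : nat) (w : nat -> nat) : Prop :=
  [/\ (forall n, 0 < w n),
      {homo w : m n / m < n} &
      exists N, forall m, N <= m ->
        exists s : seq nat,
          [/\ sorted ltn s, size s = k & m = \sum_(i <- s) w i]].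

(* [partial_sum x n] is x_1 + ... + x_n, where x_(i+1) is [x i]. *)
Definition partial_sum (x : nat -> nat) (n : nat) : nat := \sum_(i < n) x i.

Section random_variables.
Context (d : measure_display) (T : measurableType d) (R : realType).
Context (P : probability T R).
Local Open Scope ereal_scope.

Definition Supp (X : {RV P >-> nat}) : set nat :=
  [set x | 0 < P (X @^-1` [set x])].

Definition mutually_independent (X : nat -> {RV P >-> nat}) : Prop :=
  forall (J : seq nat) (B : nat -> set nat), uniq J ->
    (forall i, measurable (B i)) ->
    P (\bigcap_(i in [set` J]) (X i @^-1` B i)) =
    \prod_(i <- J) P (X i @^-1` B i).

Definition same_distribution (X Y : {RV P >-> nat}) : Prop :=
  forall B : set nat, measurable B -> distribution P X B = distribution P Y B.

End random_variables.

(* Main.v *)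
Require Import Defs.
From HB Require Import structures.
From mathcomp Require Import all_boot all_order all_algebra.
From mathcomp Require Import all_classical all_reals all_analysis.
From mathcomp Require Import measurable_realfun.
From mathcomp Require Import ring lra zify.

Import Order.TTheory GRing.Theory Num.Theory.

Local Open Scope classical_set_scope.
Local Open Scope ring_scope.

(* If W_n <= c n eventually for some c < 2, then for m large more than m/2 of
   the W_i lie in [1, m - 1], so two of them lie in the same pair {x, m - x}
   and add up to m. The bound on W_n is the upper half of the strong law of
   large numbers, proved as by Etemadi. With all summands truncated at level k,
   Chebyshev's inequality bounds P(W_k > (E X + eps) k) by a constant times
   E[min(X, k)^2] / k. Along k = q 2^n this is summable in n, because
   sum_n min(x, q 2^n)^2 / (q 2^n) <= 4 x, and Borel-Cantelli applies. As W is
   nondecreasing, the bound for all q in [M, 2 M] with M large extends to every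
   index, at the cost of a factor 1 + 1/M. *)

(** * Pairs of terms adding up to a given integer *)

Lemma sum_of_two_terms (w : nat -> nat) (m : nat) :
    (forall n, 0 < w n)%N -> {homo w : i j / (i < j)%N} -> (w m./2 < m)%N ->
  exists s : seq nat,
    [/\ sorted ltn s, size s = 2%N & m = \sum_(i <- s) w i]%N.
Proof.
move=> w0 wlt wm.
have wle i : (i <= m./2)%N -> (w i < m)%N.
  by rewrite leq_eqVlt => /predU1P[->//|/wlt]; lia.
(* The smaller of [w i] and [m - w i] lies between 1 and [m./2]; its predecessor lies in ['I_m./2],
   which has one element fewer than the set of indices [i]. *)
have fold_lt (i : 'I_m./2.+1) : ((minn (w i) (m - w i)).-1 < m./2)%N.
  by have := w0 i; have := wle i (ltn_ord i); lia.
(* Both elements of a pair {x, m - x} have the same image under [fold]. *)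
pose fold i := Ordinal (fold_lt i).
suff [i [j [ij mE]]] : exists i j : nat, (i < j)%N /\ (w i + w j = m)%N.
  by exists [:: i; j]; split; rewrite /= ?ij// !big_cons big_nil addn0.
have /injectiveP/injectivePn[i [j ij /(congr1 val)/= fij]] : ~ injective fold.
  by move=> /leq_card; rewrite !card_ord ltnn.
have := wle i (ltn_ord i); have := wle j (ltn_ord j).
have := w0 i; have := w0 j.
(* Equal images leave [w i = w j] or [w i + w j = m]; strict monotonicity excludes the first. *)
have [lij|lij|/val_inj] := ltngtP i j; last by move/eqP: ij.
- by have := wlt _ _ lij; exists i, j; split => //; lia.
- by have := wlt _ _ lij; exists j, i; split => //; lia.
Qed.

Lemma partial_sum_pos (x : nat -> nat) (n : nat) :
  (forall i, 0 < x i)%N -> (0 < partial_sum x n.+1)%N.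
Proof. by move=> x0; rewrite /partial_sum big_ord_recr ltn_addl. Qed.

Lemma partial_sum_lt (x : nat -> nat) :
  (forall i, 0 < x i)%N -> {homo partial_sum x : i j / (i < j)%N}.
Proof.
move=> x0; apply: homo_ltn => [|i]; first exact: ltn_trans.
by rewrite /partial_sum big_ord_recr /= -[ltnLHS]addn0 ltn_add2l.
Qed.

Lemma partial_sum_le (x : nat -> nat) :
  {homo partial_sum x : i j / (i <= j)%N}.
Proof.
apply: homo_leq => [//||i]; first exact: leq_trans.
by rewrite /partial_sum big_ord_recr leq_addr.
Qed.

Lemma asymptotically_2_complete (R : realType) (x : nat -> nat) (c : R) :
    (forall i, 0 < x i)%N -> c < 2 ->
    (exists N, forall n, (N <= n)%N -> (partial_sum x n)%:R <= c * n%:R) ->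
  asymptotically_complete 2 (fun n => partial_sum x n.+1).
Proof.
move=> x0 c2 [N xc]; split=> [n|i j ij|]; first exact: partial_sum_pos.
  exact: partial_sum_lt.
have c0 : 0 <= c.
  rewrite -(@pmulr_lge0 _ N.+1%:R)//.
  exact: le_trans (ler0n _ _) (xc _ (leqnSn N)).
(* The goal will be [c * m./2.+1 < m], and [m./2] is at most m/2, so m (1 - c/2) > c is enough. The
   summand [N.*2] of the threshold puts [m./2.+1] in the range of the linear bound. *)
have [K cK] : exists K : nat, c + 1 < K%:R * (1 - c / 2).
  exists (Num.bound ((c + 1) / (1 - c / 2))).
  rewrite -ltr_pdivrMr; last by lra.
  by rewrite archi_boundP// divr_ge0//; lra.
exists (N.*2 + K)%N => m Nm; apply: sum_of_two_terms => [n|i j ij|].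
- exact: partial_sum_pos.
- exact: partial_sum_lt.
have {}xc : (partial_sum x m./2.+1)%:R <= c * m./2.+1%:R by apply: xc; lia.
rewrite -(ltr_nat R); apply: le_lt_trans xc _.
have : K%:R * (1 - c / 2) <= m%:R * (1 - c / 2).
  by rewrite ler_wpM2r ?ler_nat; [|lra|lia].
have : c * (m./2)%:R <= c * (m%:R / 2).
  rewrite ler_wpM2l// ler_pdivlMr// -natrM ler_nat; lia.
by move=> ? ?; rewrite -[in X in c * X]natr1; lra.
Qed.

(** * From the subsequences q 2^n to all indices *)

Lemma eventually_le_linear (R : realType) (w : nat -> nat) (c c' : R) :
    {homo w : i j / (i <= j)%N} -> 0 <= c < c' ->
    (forall q, exists N, forall n, (N <= n)%N ->
       (w (q.+1 * 2 ^ n)%N)%:R <= c * (q.+1 * 2 ^ n)%:R) ->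
  exists N, forall n, (N <= n)%N -> (w n)%:R <= c' * n%:R.
Proof.
move=> wle /andP[c0 cc'] /choice[N Nw].
have [M M0 cM] : exists2 M : nat, (0 < M)%N & c * (1 + M%:R^-1) <= c'.
  exists (Num.bound (c / (c' - c))).+1 => //.
  rewrite mulrDr mulr1 -lerBrDl ler_pdivrMr// mulrC -ler_pdivrMr ?subr_gt0//.
  rewrite -natr1 ler_wpDr// ltW// archi_boundP// divr_ge0// subr_ge0 ltW//.
(* Only multipliers below [M.*2] occur, so finitely many thresholds have to be met. *)
pose N' := (\max_(q < M.*2) N q)%N.
exists (M * 2 ^ N')%N => j jN.
(* With this [n], [2 ^ n <= j %/ M < 2 ^ n.+1], which places [j %/ 2 ^ n] in [M, 2M). *)
pose n := trunc_log 2 (j %/ M).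
have jM : (2 ^ N' <= j %/ M)%N by rewrite leq_divRL// mulnC.
have jM0 : (0 < j %/ M)%N by apply: leq_trans jM; rewrite expn_gt0.
have N'n : (N' <= n)%N by apply: trunc_log_max.
pose q := (j %/ 2 ^ n)%N.
have n0 : (0 < 2 ^ n)%N by rewrite expn_gt0.
have Mq : (M <= q)%N.
  rewrite leq_divRL// mulnC -leq_divRL//; exact: trunc_logP.
have qM : (q < M.*2)%N.
  rewrite ltn_divLR// -mul2n mulnC mulnA -ltn_divLR//.
  by rewrite -expnSr; exact: trunc_log_ltn.
have qj : (q * 2 ^ n <= j)%N by rewrite -leq_divRL.
have jq : (j <= q.+1 * 2 ^ n)%N by rewrite ltnW// -ltn_divLR.
have Nn : (N q <= n)%N.
  by apply: leq_trans N'n; exact: (leq_bigmax (Ordinal qM)).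
apply: (@le_trans _ _ (w (q.+1 * 2 ^ n)%N)%:R); first by rewrite ler_nat wle.
apply: le_trans (Nw _ _ Nn) _.
(* The ratio (q + 1) / q is at most 1 + 1/M because [M <= q]. *)
apply: (@le_trans _ _ (c * (1 + M%:R^-1) * (q * 2 ^ n)%:R)); last first.
  by rewrite ler_pM ?mulr_ge0 ?addr_ge0 ?invr_ge0 ?ler_nat.
rewrite -mulrA ler_wpM2l// mulrDl mul1r mulSn addnC natrD lerD2l.
rewrite mulrC ler_pdivlMr ?ltr0n// -natrM ler_nat mulnC leq_mul2r Mq orbT//.
Qed.

(** * Deterministic estimates for truncations *)

(** As long as q 2^n <= x, the terms equal q 2^n; they double and add up to at most 2 x. Afterwards
    they equal x^2 / (q 2^n); they halve and again add up to at most 2 x. *)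
Lemma sum_minn_sqr_dyadic (R : realFieldType) (x q N : nat) : (0 < q)%N ->
  \sum_(n < N) (minn x (q * 2 ^ n))%:R ^+ 2 / (q * 2 ^ n)%:R <= 4 * x%:R :> R.
Proof.
move=> q0; pose k n : R := (q * 2 ^ n)%:R.
have k0 n : 0 < k n by rewrite ltr0n muln_gt0 q0 expn_gt0.
have kS n : k n.+1 = 2 * k n by rewrite /k expnS mulnCA natrM.
pose S M := \sum_(n < M) (minn x (q * 2 ^ n))%:R ^+ 2 / k n.
have SS n : S n.+1 = S n + (minn x (q * 2 ^ n))%:R ^+ 2 / k n.
  by rewrite /S big_ord_recr.
(* [Sk] serves while [k n] is below [x]; from then on [Sx] is inductive. *)
have Sk n : S n <= k n.
  elim: n => [|n IH]; first by rewrite /S big_ord0 ltW.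
  rewrite SS kS [leRHS]mulrDl mul1r lerD// ler_pdivrMr//.
  rewrite -expr2 lerXn2r ?nnegrE ?ler0n ?(ltW (k0 n))//.
  by rewrite /k ler_nat geq_minr.
(* The subtracted quantity is the full tail of the halving series from index [n] on; reserving it
   makes the induction close. *)
have Sx n : x%:R <= k n -> S n <= 4 * x%:R - 2 * (x%:R ^+ 2 / k n).
  have xk l : x%:R <= k l -> x%:R ^+ 2 / k l <= x%:R.
    by move=> ?; rewrite ler_pdivrMr// expr2 ler_wpM2l.
  elim: n => [|n IH] xkn.
    by rewrite /S big_ord0; have := xk _ xkn; have : 0 <= x%:R :> R by []; lra.
  have [{}/IH IH|kx] := leP x%:R (k n).
    rewrite SS kS; apply: (@le_trans _ _ (S n + x%:R ^+ 2 / k n)).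
      rewrite lerD2l ler_pM2r ?invr_gt0// lerXn2r ?nnegrE// ler_nat geq_minl//.
    have -> : 2 * (x%:R ^+ 2 / (2 * k n)) = x%:R ^+ 2 / k n.
      by rewrite invfM mulrCA [2 * (_ * _)]mulrA divff ?pnatr_eq0// mul1r.
    lra.
  apply: le_trans (Sk _) _.
  rewrite lerBrDr -lerBrDl mulrA ler_pdivrMr//.
  (* At the crossing, [k n.+1] lies in [x, 2x]. With k for [k n.+1], the two products yield 2 x^2 <=
     (4 x - k) k. *)
  have : 0 <= (k n.+1 - x%:R) * (2 * x%:R - k n.+1).
    by rewrite mulr_ge0// subr_ge0// kS ler_pM2l// ltW.
  have : 0 <= x%:R * (k n.+1 - x%:R) by rewrite mulr_ge0// subr_ge0.
  nra.
rewrite -/(S N); have [xk|/ltW kx] := leP x%:R (k N).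
  apply: le_trans (Sx _ xk) _.
  by rewrite gerBl mulr_ge0// divr_ge0// ltW.
apply: le_trans (Sk _) (le_trans kx _).
by have : 0 <= x%:R :> R by []; lra.
Qed.

(** This layer-cake form reduces expectations of truncations to probabilities of the events a < X,
    where independence, stated for events, can act. *)
Lemma minn_sum_ltn (R : pzSemiRingType) (x k : nat) :
  (minn x k)%:R = \sum_(a < k) (a < x)%N%:R :> R.
Proof.
elim: k => [|k IH]; first by rewrite minn0 big_ord0.
rewrite big_ord_recr /= -IH -natrD; congr _%:R; lia.
Qed.

(* Chebyshev's inequality in a form without subtraction, so that it can be
   integrated term by term with the additivity of integrals of nonnegative
   functions; if some [x i] exceeds [k], the last sum alone is large enough. *)
Lemma truncation_deviation (R : realFieldType) (x : nat -> nat) (k : nat)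
    (m mu eps S : R) : m <= mu -> 0 < eps ->
    S = \sum_(i < k) (minn (x i) k)%:R ->
  (eps * k%:R) ^+ 2 * ((mu + eps) * k%:R < (partial_sum x k)%:R)%R%:R
    + 2 * (k%:R * m) * S <=
  S ^+ 2 + (k%:R * m) ^+ 2 + eps ^+ 2 * \sum_(i < k) (minn (x i) k)%:R ^+ 2.
Proof.
move=> mmu eps0 S_def.
have sq : 2 * (k%:R * m) * S <= S ^+ 2 + (k%:R * m) ^+ 2.
  by rewrite -subr_ge0 (_ : _ - _ = (S - k%:R * m) ^+ 2) ?sqr_ge0//; ring.
have eQ0 : 0 <= eps ^+ 2 * \sum_(i < k) (minn (x i) k)%:R ^+ 2.
  by rewrite mulr_ge0 ?sqr_ge0 ?sumr_ge0// => i _; exact: sqr_ge0.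
case: ltP => [Wk|_]; last by rewrite mulr0 add0r; lra.
rewrite mulr1.
have [xk|] := boolP [forall i : 'I_k, x i <= k]%N; last first.
  rewrite negb_forall => /existsP[i]; rewrite -ltnNge => kx.
  suff : (eps * k%:R) ^+ 2 <= eps ^+ 2 * \sum_(i < k) (minn (x i) k)%:R ^+ 2.
    by lra.
  rewrite exprMn ler_wpM2l ?sqr_ge0// (bigD1 i)//=.
  by rewrite (minn_idPr (ltnW kx)) lerDl sumr_ge0// => j _; exact: sqr_ge0.
have SE : S = (partial_sum x k)%:R.
  rewrite S_def /partial_sum natr_sum; apply: eq_bigr => i _.
  by rewrite (minn_idPl (forallP xk i)).
have epsk : 0 <= eps * k%:R by rewrite mulr_ge0// ltW.
have dev : eps * k%:R <= S - k%:R * m.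
  have : k%:R * m <= k%:R * mu by rewrite ler_wpM2l.
  by rewrite SE; lra.
have : (eps * k%:R) ^+ 2 <= (S - k%:R * m) ^+ 2.
  by rewrite lerXn2r// nnegrE// (le_trans epsk).
by rewrite sqrrB => dev2; lra.
Qed.

Local Open Scope ereal_scope.

(** * Measurability, and truncated expectations as sums of probabilities *)

Section random_walk.
Context (d : measure_display) (T : measurableType d) (R : realType).
Context (P : probability T R).

Lemma measurable_comp_nat (d' : measure_display) (U : measurableType d')
    (Z : {RV P >-> nat}) (f : nat -> U) :
  measurable_fun setT (fun t => f (Z t)).
Proof. by apply: (measurableT_comp (f := f)). Qed.

Lemma measurable_minn (Z : {RV P >-> nat}) (k : nat) :
  measurable_fun setT (fun t => (minn (Z t) k)%:R : R).
Proof. exact: (measurable_comp_nat _ _ Z (fun n => (minn n k)%:R : R)). Qed.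

Lemma same_distribution_preimage (Z Z' : {RV P >-> nat}) (A : set nat) :
  same_distribution Z Z' -> P (Z @^-1` A) = P (Z' @^-1` A).
Proof. by move=> /(_ A); exact. Qed.

Lemma same_distribution_integral (Z Z' : {RV P >-> nat}) (f : nat -> \bar R) :
    same_distribution Z Z' -> (forall n, 0 <= f n) ->
  \int[P]_t f (Z t) = \int[P]_t f (Z' t).
Proof.
move=> ZZ' f0.
transitivity (\int[distribution P Z]_n f n).
  by rewrite ge0_integral_distribution.
transitivity (\int[distribution P Z']_n f n).
  by apply: eq_measure_integral => A mA _; exact: ZZ'.
by rewrite ge0_integral_distribution.
Qed.

Lemma independent_pair (Xs : nat -> {RV P >-> nat}) (i j : nat)
    (A B : set nat) :
    mutually_independent Xs -> i != j ->
  P (Xs i @^-1` A `&` Xs j @^-1` B) = P (Xs i @^-1` A) * P (Xs j @^-1` B).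
Proof.
move=> indep ij; pose C l := if l == i then A else B.
have := indep [:: i; j] C; rewrite bigcap_seq /= inE ij.
rewrite !big_cons !big_nil mule1 setIT /C eqxx eq_sym (negbTE ij) => ->//.
Qed.

(** The product of two layer-cake sums is a double sum of indicators of intersections, ready to be
    factored by [independent_pair]. *)
Lemma integral_minn_mul (Z Z' : {RV P >-> nat}) (k : nat) :
  \int[P]_t ((minn (Z t) k)%:R * (minn (Z' t) k)%:R)%:E =
  \sum_(a < k) \sum_(b < k)
    P (Z @^-1` [set n | a < n]%N `&` Z' @^-1` [set n | b < n]%N).
Proof.
pose A (Y : {RV P >-> nat}) a := Y @^-1` [set n | a < n]%N.
have mA Y a : measurable (A Y a) by apply: measurable_funPTI.
have mAA a b : measurable (A Z a `&` A Z' b) by apply: measurableI.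
have AE (Y : {RV P >-> nat}) a t : (a < Y t)%N = (t \in A Y a).
  by apply/idP/idP => [?|/set_mem//]; apply/mem_set.
transitivity
  (\int[P]_t (\sum_(a < k) \sum_(b < k) (\1_(A Z a `&` A Z' b) t)%:E)).
  apply: eq_integral => t _; rewrite !minn_sum_ltn mulr_suml -sumEFin.
  apply: eq_bigr => a _; rewrite mulr_sumr -sumEFin; apply: eq_bigr => b _.
  by rewrite indicI !AE.
have mI a b :
    measurable_fun setT (EFin \o (\1_(A Z a `&` A Z' b) : T -> R)).
  by apply/measurable_EFinP; apply: measurable_indic.
rewrite ge0_integral_sum//; last 2 first.
- by move=> a; apply: emeasurable_sum => b _; exact: mI.
- by move=> a t _; apply: sume_ge0 => b _; rewrite lee_fin.
apply: eq_bigr => a _; rewrite ge0_integral_sum//; last first.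
  by move=> b; exact: mI.
by apply: eq_bigr => b _; rewrite integral_indic// setIT.
Qed.

Lemma integral_minn (Z : {RV P >-> nat}) (k : nat) :
  \int[P]_t ((minn (Z t) k)%:R)%:E =
  \sum_(a < k) P (Z @^-1` [set n | a < n]%N).
Proof.
pose A a := Z @^-1` [set n | a < n]%N.
have mA a : measurable (A a) by apply: measurable_funPTI.
have AE a t : (a < Z t)%N = (t \in A a).
  by apply/idP/idP => [?|/set_mem//]; apply/mem_set.
transitivity (\int[P]_t (\sum_(a < k) (\1_(A a) t)%:E)).
  apply: eq_integral => t _; rewrite minn_sum_ltn -sumEFin.
  by apply: eq_bigr => a _; rewrite indicE AE.
rewrite ge0_integral_sum//; last first.
  by move=> a; apply/measurable_EFinP; apply: measurable_indic.
by apply: eq_bigr => a _; rewrite integral_indic// setIT.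
Qed.

Lemma integral_le_cst (f : T -> R) (c : R) :
    measurable_fun setT f -> (forall t, 0 <= f t <= c)%R ->
  \int[P]_t (f t)%:E <= c%:E.
Proof.
move=> mf fc; rewrite -[leRHS]mule1 -(probability_setT P) -integral_cst//.
apply: ge0_le_integral => //.
- by move=> t _; rewrite lee_fin; have /andP[] := fc t.
- exact/measurable_EFinP.
- by move=> t _; rewrite lee_fin; have /andP[] := fc t.
Qed.

Lemma measurable_partial_sum (Xs : nat -> {RV P >-> nat}) (k : nat) :
  measurable_fun setT (fun t => partial_sum (fun i => Xs i t) k).
Proof.
elim: k => [|k IH].
  rewrite (_ : (fun t => _) = cst 0%N)//.
  by apply/funext => t; rewrite /partial_sum big_ord0.
rewrite (_ : (fun t => _) =
  fun t => (partial_sum (fun i => Xs i t) k + Xs k t)%N).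
  exact: measurable_fun_addn.
by apply/funext => t; rewrite /partial_sum big_ord_recr.
Qed.

Lemma measurable_partial_sum_gt (Xs : nat -> {RV P >-> nat}) (k : nat) (c : R) :
  measurable [set t | c < (partial_sum (fun i => Xs i t) k)%:R]%R.
Proof.
have := measurable_partial_sum Xs k measurableT [set n | c < n%:R]%R I.
by rewrite setTI.
Qed.

(** * First and second moments of truncated sums *)

Section iid.
Context (Xs : nat -> {RV P >-> nat}) (X : {RV P >-> nat}).
Context (Xs_indep : mutually_independent Xs).
Context (Xs_distr : forall n, same_distribution (Xs n) X).

(** Both sides are the double sum of P(a < X) P(b < X) over a, b < k. *)
Lemma integral_minn_mul_indep (i j k : nat) : i != j ->
  \int[P]_t ((minn (Xs i t) k)%:R * (minn (Xs j t) k)%:R)%:E =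
  (\int[P]_t ((minn (X t) k)%:R)%:E) ^+ 2.
Proof.
move=> ij; rewrite integral_minn_mul integral_minn expe2.
rewrite ge0_sume_distrl; last by move=> a _; exact: measure_ge0.
apply: eq_bigr => a _; rewrite ge0_sume_distrr; last first.
  by move=> b _; exact: measure_ge0.
apply: eq_bigr => b _; rewrite independent_pair//.
by rewrite !(same_distribution_preimage _ X).
Qed.

Lemma integral_sum_minn (n k : nat) :
  \int[P]_t (\sum_(i < n) (minn (Xs i t) k)%:R)%:E =
  n%:R%:E * \int[P]_t ((minn (X t) k)%:R)%:E.
Proof.
under eq_integral do rewrite -sumEFin.
rewrite ge0_integral_sum//; last first.
  by move=> i; apply/measurable_EFinP; exact: measurable_minn.
transitivity (\sum_(i < n) \int[P]_t ((minn (X t) k)%:R)%:E).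
  apply: eq_bigr => i _.
  exact: (@same_distribution_integral _ _ (fun x => ((minn x k)%:R)%:E)).
by rewrite sumr_const card_ord mule_natl.
Qed.

Lemma integral_sum_minn_sqr (n k : nat) :
  \int[P]_t (\sum_(i < n) (minn (Xs i t) k)%:R ^+ 2)%:E =
  n%:R%:E * \int[P]_t ((minn (X t) k)%:R ^+ 2)%:E.
Proof.
under eq_integral do rewrite -sumEFin.
rewrite ge0_integral_sum//; last first.
  move=> i; apply/measurable_EFinP; apply: measurable_funX.
  exact: measurable_minn.
transitivity (\sum_(i < n) \int[P]_t ((minn (X t) k)%:R ^+ 2)%:E).
  apply: eq_bigr => i _.
  apply: (@same_distribution_integral _ _
    (fun x => ((minn x k)%:R ^+ 2)%:E)) => //.
by rewrite sumr_const card_ord mule_natl.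
Qed.

(** In the expanded square, each row has one diagonal term v and n - 1 off-diagonal terms m^2.
    Counting n of the latter gives the upper bound and completes the square (n m)^2. *)
Lemma integral_sqr_sum_minn (n k : nat) :
  \int[P]_t ((\sum_(i < n) (minn (Xs i t) k)%:R) ^+ 2)%:E <=
  n%:R%:E * \int[P]_t ((minn (X t) k)%:R ^+ 2)%:E +
  (n%:R%:E * \int[P]_t ((minn (X t) k)%:R)%:E) ^+ 2.
Proof.
pose Y i t : R := (minn (Xs i t) k)%:R.
have mY i j : measurable_fun setT (fun t => (Y i t * Y j t)%:E).
  by apply/measurable_EFinP; apply: measurable_funM; exact: measurable_minn.
have Y0 i j t : 0 <= (Y i t * Y j t)%:E by rewrite lee_fin mulr_ge0.
set v := \int[P]_t ((minn (X t) k)%:R ^+ 2)%:E.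
set m := \int[P]_t ((minn (X t) k)%:R)%:E.
have v0 : 0 <= v by apply: integral_ge0 => t _; rewrite lee_fin sqr_ge0.
have m0 : 0 <= m by apply: integral_ge0 => t _; rewrite lee_fin.
have mm0 : 0 <= m ^+ 2 by rewrite expe2 mule_ge0.
have -> : \int[P]_t ((\sum_(i < n) Y i t) ^+ 2)%:E =
    \sum_(i < n) \sum_(j < n) \int[P]_t (Y i t * Y j t)%:E.
  transitivity (\int[P]_t \sum_(i < n) \sum_(j < n) (Y i t * Y j t)%:E).
    apply: eq_integral => t _; rewrite expr2 mulr_suml -sumEFin.
    by apply: eq_bigr => i _; rewrite mulr_sumr -sumEFin.
  rewrite ge0_integral_sum//; last 2 first.
  - by move=> i; apply: emeasurable_sum => j _; exact: mY.
  - by move=> i t _; apply: sume_ge0 => j _; exact: Y0.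
  apply: eq_bigr => i _; rewrite ge0_integral_sum// => j; exact: mY.
apply: (@le_trans _ _ (\sum_(i < n) (v + n%:R%:E * m ^+ 2))).
  apply: lee_sum => i _; rewrite (bigD1 i)//= leeD//.
    rewrite le_eqVlt; apply/orP; left; apply/eqP.
    transitivity (\int[P]_t (Y i t ^+ 2)%:E) => //.
    apply: (@same_distribution_integral _ _
      (fun x => ((minn x k)%:R ^+ 2)%:E)) => //.
  apply: (@le_trans _ _ (\sum_(j < n) m ^+ 2)).
    rewrite [leRHS](bigD1 i)//= -[leLHS]add0e leeD//.
    by apply: lee_sum => j ij; rewrite integral_minn_mul_indep// eq_sym.
  by rewrite sumr_const card_ord mule_natl.
apply: (@le_trans _ _ (n%:R%:E * (v + n%:R%:E * m ^+ 2))).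
  by rewrite sumr_const card_ord !mule_natl.
rewrite ge0_muleDr ?mule_ge0//.
by rewrite leeD// [leRHS]expe2 muleACA [leLHS]muleA.
Qed.

(** * Tail bound, Borel-Cantelli, and the almost sure linear bound *)

(** Let m and v be the first two moments of min(X, k). Integrating [truncation_deviation] and using
    [integral_sqr_sum_minn], the terms 2 (k m)^2 cancel and eps^2 k p <= (1 + eps^2) v remains for
    the probability p. In the constant, [eps ^- 2] comes from the variance and 1 from the summands
    exceeding k. *)
Lemma partial_sum_tail (mu eps : R) (k : nat) :
    \int[P]_t (X t)%:R%:E <= mu%:E -> (0 < eps)%R -> (0 < k)%N ->
  P [set t | (mu + eps) * k%:R < (partial_sum (fun i => Xs i t) k)%:R]%R <=
  (1 + eps ^- 2)%:E * \int[P]_t ((minn (X t) k)%:R ^+ 2 / k%:R)%:E.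
Proof.
move=> Xmu eps0 k0; have kR : (0 < k%:R :> R)%R by rewrite ltr0n.
set E := [set t | _].
have mE : measurable E by exact: measurable_partial_sum_gt.
pose S t : R := (\sum_(i < k) (minn (Xs i t) k)%:R)%R.
pose Q t : R := (\sum_(i < k) (minn (Xs i t) k)%:R ^+ 2)%R.
have mY Z := measurable_minn Z k.
have mS : measurable_fun setT S by apply: measurable_sum => i; exact: mY.
have mQ : measurable_fun setT Q.
  by apply: measurable_sum => i; apply: measurable_funX; exact: mY.
have S0 t : (0 <= S t)%R by apply: sumr_ge0.
have Q0 t : (0 <= Q t)%R by apply: sumr_ge0 => i _; exact: sqr_ge0.
(* Truncation at [k] makes these moments finite; as real numbers they can be cancelled in the final
   inequality. *)
have [m mE0 m0] : exists2 m : R,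
    \int[P]_t (minn (X t) k)%:R%:E = m%:E & (0 <= m)%R.
  have i0 : 0 <= \int[P]_t (minn (X t) k)%:R%:E by apply: integral_ge0.
  have ifin : \int[P]_t (minn (X t) k)%:R%:E \is a fin_num.
    rewrite ge0_fin_numE//; apply: le_lt_trans (ltry k%:R).
    by apply: integral_le_cst => // t; rewrite ler0n ler_nat geq_minr.
  by exists (fine (\int[P]_t (minn (X t) k)%:R%:E)); rewrite ?fineK ?fine_ge0.
have [v vE v0] : exists2 v : R,
    \int[P]_t ((minn (X t) k)%:R ^+ 2)%:E = v%:E & (0 <= v)%R.
  have i0 : 0 <= \int[P]_t ((minn (X t) k)%:R ^+ 2)%:E.
    by apply: integral_ge0 => t _; rewrite lee_fin sqr_ge0.
  have ifin : \int[P]_t ((minn (X t) k)%:R ^+ 2)%:E \is a fin_num.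
    rewrite ge0_fin_numE//; apply: le_lt_trans (ltry (k%:R ^+ 2)).
    apply: integral_le_cst => [|t]; first by apply: measurable_funX.
    by rewrite sqr_ge0 lerXn2r ?nnegrE// ler_nat geq_minr.
  exists (fine (\int[P]_t ((minn (X t) k)%:R ^+ 2)%:E)).
    by rewrite fineK.
  exact: fine_ge0.
have mmu : (m <= mu)%R.
  rewrite -lee_fin -mE0; apply: le_trans Xmu; apply: ge0_le_integral => //.
  - exact/measurable_EFinP.
  - apply/measurable_EFinP.
    exact: (measurable_comp_nat _ _ X (fun n => n%:R : R)).
  - by move=> t _; rewrite lee_fin ler_nat geq_minl.
have [p pE p0] : exists2 p : R, P E = p%:E & (0 <= p)%R.
  have PE : P E \is a fin_num by exact: fin_num_measure.
  by exists (fine (P E)); rewrite ?fineK ?fine_ge0.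
have mI : measurable_fun setT (EFin \o (\1_E : T -> R)).
  by apply/measurable_EFinP; exact: measurable_indic.
have m1 (c : R) : measurable_fun setT (fun t => c%:E * (\1_E t)%:E).
  exact: measurable_funeM.
have m2 (c : R) : measurable_fun setT (fun t => c%:E * (S t)%:E).
  by apply: measurable_funeM; exact/measurable_EFinP.
have m3 (c : R) : measurable_fun setT (fun t => c%:E * (Q t)%:E).
  by apply: measurable_funeM; exact/measurable_EFinP.
have m4 : measurable_fun setT (fun t => (S t ^+ 2)%:E).
  by apply/measurable_EFinP; exact: measurable_funX.
have c1 : (0 <= (eps * k%:R) ^+ 2)%R by exact: sqr_ge0.
have c2 : (0 <= 2 * (k%:R * m))%R by rewrite !mulr_ge0.
have c3 : (0 <= (k%:R * m) ^+ 2)%R by exact: sqr_ge0.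
have c4 : (0 <= eps ^+ 2)%R by exact: sqr_ge0.
have p1 (t : T) : setT t -> 0 <= ((eps * k%:R) ^+ 2)%:E * (\1_E t)%:E.
  by move=> _; rewrite -EFinM lee_fin mulr_ge0.
have p2 (t : T) : setT t -> 0 <= (2 * (k%:R * m))%:E * (S t)%:E.
  by move=> _; rewrite -EFinM lee_fin mulr_ge0.
have p3 (t : T) : setT t -> 0 <= (eps ^+ 2)%:E * (Q t)%:E.
  by move=> _; rewrite -EFinM lee_fin mulr_ge0.
have p4 (t : T) : setT t -> 0 <= (S t ^+ 2)%:E.
  by move=> _; rewrite lee_fin sqr_ge0.
have : \int[P]_t (((eps * k%:R) ^+ 2)%:E * (\1_E t)%:E
    + (2 * (k%:R * m))%:E * (S t)%:E) <=
  \int[P]_t ((S t ^+ 2)%:E + (((k%:R * m) ^+ 2)%:E + (eps ^+ 2)%:E * (Q t)%:E)).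
  apply: ge0_le_integral => //.
  - by move=> t ?; rewrite adde_ge0 ?p1 ?p2.
  - exact: emeasurable_funD.
  - by apply: emeasurable_funD => //; exact: emeasurable_funD.
  - move=> t _; rewrite -!EFinM -!EFinD lee_fin addrA indicE.
    have := @truncation_deviation _ (fun i => Xs i t) k _ _ _ (S t)
      mmu eps0 erefl.
    congr (_ * _%:R + _ <= _)%R; congr nat_of_bool.
    by apply/idP/idP => [?|/set_mem//]; apply/mem_set.
have icst : \int[P]_(t in setT) ((k%:R * m) ^+ 2)%:E = ((k%:R * m) ^+ 2)%:E.
  by rewrite -[RHS]mule1 -(probability_setT P) -integral_cst.
rewrite ge0_integralD// ge0_integralZl_EFin// integral_indic// setIT.
rewrite ge0_integralZl_EFin//; last 2 first.
- by move=> t _; rewrite lee_fin.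
- exact/measurable_EFinP.
rewrite ge0_integralD//; last 2 first.
- by move=> t ?; rewrite adde_ge0 ?p3.
- exact: emeasurable_funD.
rewrite ge0_integralD// icst ge0_integralZl_EFin//; last 2 first.
- by move=> t _; rewrite lee_fin.
- exact/measurable_EFinP.
rewrite integral_sum_minn integral_sum_minn_sqr.
rewrite [X in _ * X + _]pE mE0 vE => le1.
have le2 := integral_sqr_sum_minn k k.
rewrite mE0 vE in le2.
have := le_trans le1 (leeD2r _ le2).
rewrite expe2 -!EFinM -!EFinD lee_fin => le3.
have -> : \int[P]_t ((minn (X t) k)%:R ^+ 2 / k%:R)%:E = (v / k%:R)%:E.
  transitivity (\int[P]_t ((k%:R^-1)%:E * ((minn (X t) k)%:R ^+ 2)%:E)).
    by apply: eq_integral => t _; rewrite -EFinM mulrC.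
  rewrite ge0_integralZl_EFin// ?vE ?invr_ge0// -?EFinM 1?mulrC//.
  by apply/measurable_EFinP; exact: measurable_funX.
rewrite pE -EFinM lee_fin.
have {}le3 : (eps ^+ 2 * k%:R * p <= (1 + eps ^+ 2) * v)%R.
  by rewrite -(ler_pM2l kR); nra.
rewrite (_ : (1 + eps ^- 2) * (v / k%:R) =
  ((1 + eps ^+ 2) * v) / (eps ^+ 2 * k%:R))%R; last first.
  by field; rewrite !gt_eqF.
by rewrite ler_pdivlMr ?mulr_gt0 ?exprn_gt0// mulrC.
Qed.

(** The shift to [q.+1] keeps the indices positive, as [partial_sum_tail] and [sum_minn_sqr_dyadic]
    require. *)
Lemma partial_sum_dyadic_ae (mu c : R) (q : nat) :
    \int[P]_t (X t)%:R%:E <= mu%:E -> (mu < c)%R ->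
  {ae P, forall t, exists N, forall n, (N <= n)%N ->
    ((partial_sum (fun i => Xs i t) (q.+1 * 2 ^ n))%:R <=
      c * (q.+1 * 2 ^ n)%:R)%R}.
Proof.
move=> Xmu mc; pose k n := (q.+1 * 2 ^ n)%N.
pose F n := [set t | c * (k n)%:R < (partial_sum (fun i => Xs i t) (k n))%:R]%R.
have mF n : measurable (F n) by exact: measurable_partial_sum_gt.
have k0 n : (0 < k n)%N by rewrite muln_gt0 expn_gt0.
pose e := (c - mu)%R; have e0 : (0 < e)%R by rewrite subr_gt0.
pose C := (1 + e ^- 2)%R.
have C0 : (0 <= C)%R by rewrite addr_ge0// invr_ge0 exprn_ge0// ltW.
pose f n x : R := ((minn x (k n))%:R ^+ 2 / (k n)%:R)%R.
have f0 n x : (0 <= f n x)%R by rewrite divr_ge0// sqr_ge0.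
have mf n : measurable_fun setT (fun t => (f n (X t))%:E).
  by apply/measurable_EFinP; exact: (measurable_comp_nat _ _ X (f n)).
have PF n : P (F n) <= C%:E * \int[P]_t (f n (X t))%:E.
  have := partial_sum_tail mu e (k n) Xmu e0 (k0 n).
  by rewrite (_ : mu + e = c)%R// /e addrC subrK.
(* The bound is uniform in [N]: once sum and integral are exchanged, [sum_minn_sqr_dyadic] bounds
   the integrand by 4 X. *)
have sumPF N : \sum_(0 <= n < N) P (F n) <= (C * (4 * mu))%:E.
  rewrite big_mkord.
  apply: (@le_trans _ _ (C%:E * \int[P]_t (\sum_(n < N) (f n (X t))%:E))).
    apply: (@le_trans _ _ (\sum_(n < N) C%:E * \int[P]_t (f n (X t))%:E)).
      exact: lee_sum.
    rewrite -ge0_sume_distrr; last first.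
      by move=> n _; apply: integral_ge0 => t _; rewrite lee_fin.
    by rewrite ge0_integral_sum// => n t _; rewrite lee_fin.
  rewrite EFinM lee_wpmul2l ?lee_fin//.
  apply: (@le_trans _ _ (\int[P]_t (4%:E * (X t)%:R%:E))).
    apply: ge0_le_integral => //.
    - by move=> t _; apply: sume_ge0 => n _; rewrite lee_fin.
    - by apply: emeasurable_sum.
    - apply: measurable_funeM; apply/measurable_EFinP.
      exact: (measurable_comp_nat _ _ X (fun n => n%:R : R)).
    - by move=> t _; rewrite sumEFin -EFinM lee_fin sum_minn_sqr_dyadic.
  rewrite ge0_integralZl_EFin//.
    by rewrite EFinM lee_wpmul2l.
  apply/measurable_EFinP.
  exact: (measurable_comp_nat _ _ X (fun n => n%:R : R)).
have limF : P (lim_sup_set F) = 0.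
  apply: lim_sup_set_cvg0 => //; apply: le_lt_trans (ltry (C * (4 * mu))).
  apply: lime_le; first by apply: is_cvg_nneseries.
  exact: nearW.
(* A point outside this null set lies in only finitely many [F n]. *)
exists (lim_sup_set F); split => //.
  by apply: bigcapT_measurable => n; apply: bigcup_measurable.
move=> t /= tF N _; apply: contrapT => NF; apply: tF; exists N => n Nn.
rewrite leNgt; apply/negP => Fn; by apply: NF; exists n.
Qed.

Theorem partial_sum_ae_le_linear (c : R) : \int[P]_t (X t)%:R%:E < c%:E ->
  {ae P, forall t, exists N, forall n, (N <= n)%N ->
    ((partial_sum (fun i => Xs i t) n)%:R <= c * n%:R)%R}.
Proof.
have i0 : 0 <= \int[P]_t (X t)%:R%:E by apply: integral_ge0.
move=> Xc; have ifin : \int[P]_t (X t)%:R%:E \is a fin_num.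
  by rewrite ge0_fin_numE// (lt_trans Xc) ?ltry.
have [mu muE mu0] : exists2 mu : R, \int[P]_t (X t)%:R%:E = mu%:E & (0 <= mu)%R.
  by exists (fine (\int[P]_t (X t)%:R%:E)); rewrite ?fineK ?fine_ge0.
rewrite muE lte_fin in Xc.
(* The gap between [mu] and [c] is spent in two halves: up to [b] on the deviation in the tail
   bound, from [b] to [c] on the interpolation factor 1 + 1/M. *)
have [mb bc] := midf_lt Xc; set b := ((mu + c) / 2)%R in mb bc.
have Xmu : \int[P]_t (X t)%:R%:E <= mu%:E by rewrite muE.
have dyadic q := partial_sum_dyadic_ae mu b q Xmu mb.
(* There are countably many [q], so a single null set serves them all. *)
apply: filterS (ae_foralln dyadic) => t; apply: eventually_le_linear.
  exact: partial_sum_le.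
by rewrite bc (le_trans mu0)// ltW.
Qed.

End iid.
End random_walk.

Theorem corollary1p5 (d : measure_display) (T : measurableType d)
    (R : realType) (P : probability T R)
    (Xs : nat -> {RV P >-> nat}) (X : {RV P >-> nat})
    (Xs_pos : forall n t, (0 < Xs n t)%N)
    (Xs_indep : mutually_independent Xs)
    (Xs_distr : forall n, same_distribution (Xs n) X)
    (gcd_Supp : is_gcd (Supp X) 1)
    (EX_lt2 : 'E_P[fun t => (X t)%:R] < 2%:E) :
  {ae P, forall t,
    asymptotically_complete 2 (fun n => partial_sum (fun i => Xs i t) n.+1)}.
Proof.
(* The strict inequality leaves room for a slope [c] between E X and 2; [i0] rules out the value -oo
   in the case analysis. *)
have [c Xc c2] : exists2 c : R, \int[P]_t (X t)%:R%:E < c%:E & (c < 2)%R.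
  have i0 : 0 <= \int[P]_t (X t)%:R%:E by apply: integral_ge0.
  move: EX_lt2 i0; rewrite unlock; case: (\int[P]_t _) => // r.
  by rewrite lte_fin => r2 _; have [] := midf_lt r2; exists ((r + 2) / 2)%R.
have := partial_sum_ae_le_linear _ _ _ _ _ _ Xs_indep Xs_distr c Xc.
by apply: filterS => t; exact: asymptotically_2_complete.
Qed.
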